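(* The class of trees is superrigid, that is, if $T$ is a tree and $G$ is a graph such that $T$ is quantum isomorphic to $G$, then $G$ is isomorphic to $T$.
   Context: Graphs are finite, simple and undirected, with at least one vertex. A magic unitary with coefficients in a nonzero unital $C^*$-algebra $X$ is a square matrix whose entries are self-adjoint projections of $X$ with every row and column summing to $1_X$. Two graphs $G$ and $H$ with equally many vertices are quantum isomorphic if there is a magic unitary $U$, with coefficients in some nonzero unital $C^*$-algebra, rows indexed by $V(H)$ and columns by $V(G)$, with $U\,\mathrm{Adj}(G)=\mathrm{Adj}(H)\,U$ ($\mathrm{Adj}$ = adjacency matrix). *)

(* Defs.v *)
From HB Require Import structures.
From mathcomp Require Import all_boot all_order all_algebra.
From mathcomp Require Import complex.
From mathcomp Require Import all_classical all_reals all_analysis.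

Set Implicit Arguments.
Unset Strict Implicit.
Unset Printing Implicit Defensive.

Import Order.TTheory GRing.Theory Num.Theory.
Import numFieldNormedType.Exports.

Local Open Scope ring_scope.
Local Open Scope complex_scope.

(* Complex scalars are R[i] for a realType R.  The norm of a normed module    *)
(* over R[i] takes its values in R[i], where 0 <= z forces z to be real.      *)
(* Multiplication is added on top of a Banach space because Hierarchy-Builder *)
(* admits no join of GRing.Algebra and NormedModule: it would have to sit     *)
(* above the existing Num.NumDomain.  The clause cs_one != 0 says that the    *)
(* algebra is nonzero.                                                        *)
Record cstarAlgType (R : realType) := CStarAlg {
  cs_banach : completeNormedModType R[i];
  cs_one : cs_banach;
  cs_mul : cs_banach -> cs_banach -> cs_banach;
  cs_star : cs_banach -> cs_banach;
  cs_mulA : associative cs_mul;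
  cs_mul1r : left_id cs_one cs_mul;
  cs_mulr1 : right_id cs_one cs_mul;
  cs_mulDl : left_distributive cs_mul +%R;
  cs_mulDr : right_distributive cs_mul +%R;
  cs_one_neq0 : cs_one != 0;
  cs_scaleAl : forall a x y, a *: cs_mul x y = cs_mul (a *: x) y;
  cs_scaleAr : forall a x y, a *: cs_mul x y = cs_mul x (a *: y);
  cs_starK : involutive cs_star;
  cs_starD : {morph cs_star : x y / x + y};
  cs_starZ : forall a x, cs_star (a *: x) = (a^*)%C *: cs_star x;
  cs_starM : forall x y, cs_star (cs_mul x y) = cs_mul (cs_star y) (cs_star x);
  cs_normM : forall x y, `|cs_mul x y| <= `|x| * `|y|;
  cs_norm_star : forall x, `|cs_mul (cs_star x) x| = `|x| ^+ 2
}.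

Definition cs_carrier (R : realType) (X : cstarAlgType R) : Type :=
  cs_banach X.
Coercion cs_carrier : cstarAlgType >-> Sortclass.

Section CStarAlgebraInstances.
Variables (R : realType) (X : cstarAlgType R).

HB.instance Definition _ := CompleteNormedModule.on (cs_carrier X).
HB.instance Definition _ := GRing.Zmodule_isNzRing.Build (cs_carrier X)
  (@cs_mulA R X) (@cs_mul1r R X) (@cs_mulr1 R X)
  (@cs_mulDl R X) (@cs_mulDr R X) (@cs_one_neq0 R X).
HB.instance Definition _ :=
  GRing.Lmodule_isLalgebra.Build R[i] (cs_carrier X) (@cs_scaleAl R X).
HB.instance Definition _ :=
  GRing.Lalgebra_isAlgebra.Build R[i] (cs_carrier X) (@cs_scaleAr R X).

End CStarAlgebraInstances.

Definition star (R : realType) (X : cstarAlgType R) (x : X) : X := cs_star x.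

Definition is_projection (R : realType) (X : cstarAlgType R) (p : X) : Prop :=
  star p = p /\ p * p = p.

(* The two dimensions are kept apart because rows and columns will be indexed *)
(* by the vertices of two different graphs; being square is the first clause. *)
Definition is_magic_unitary (R : realType) (X : cstarAlgType R) (m n : nat)
    (U : 'M[X]_(m, n)) : Prop :=
  [/\ m = n,
      forall i j, is_projection (U i j),
      forall i, \sum_j U i j = 1
    & forall j, \sum_i U i j = 1].

Record graph := Graph {
  vertex :> finType;
  adj : rel vertex;
  adj_sym : symmetric adj;
  adj_irr : irreflexive adj;
  vertex_gt0 : (0 < #|vertex|)%N
}.

Definition adj_mx (X : pzSemiRingType) (G : graph) : 'M[X]_#|G| :=
  \matrix_(i, j) (adj (enum_val i : G) (enum_val j))%:R.

Definition quantum_isomorphic (R : realType) (G H : graph) : Prop :=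
  #|G| = #|H| /\
  exists (X : cstarAlgType R) (U : 'M[X]_(#|H|, #|G|)),
    is_magic_unitary U /\ U *m adj_mx X G = adj_mx X H *m U.

Definition graph_isomorphic (G H : graph) : Prop :=
  exists2 f : G -> H, bijective f & {mono f : x y / adj x y}.

Definition connected_graph (G : graph) : Prop :=
  forall x y : G, connect (@adj G) x y.

(* An edge traversed back and forth is a ucycle of size 2, hence the bound. *)
Definition acyclic_graph (G : graph) : Prop :=
  forall c : seq G, ucycle (@adj G) c -> (size c <= 2)%N.

Definition is_tree (G : graph) : Prop :=
  connected_graph G /\ acyclic_graph G.

Definition superrigid (R : realType) (C : graph -> Prop) : Prop :=
  forall T G : graph, C T -> quantum_isomorphic R T G -> graph_isomorphic G T.

(* Main.v *)
(** Colour the vertices of both graphs by the connected components of the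
    bipartite relation [U y x != 0].  For a colour [c], let [d(z)] be the number
    of neighbours of [z] of colour [c].  The magic unitary equations give
    [sum_x U y x * d(x) = d(y)] and [sum_y U y x * d(y) = d(x)], hence
    [sum_(x, y) U y x * (d(x) - d(y))^2 = 0].  A sum of projections with
    nonnegative weights vanishes only if every term does, so [d(x) = d(y)]
    whenever [U y x != 0]: the colouring is equitable, and its classes have the
    same size in both graphs.  An acyclic graph is determined by such a
    colouring: remove a whole colour class of leaves, or a single edge whose two
    ends are leaves of the same colour, and extend the isomorphism obtained by
    induction. *)
Require Import Defs.
From mathcomp Require Import all_boot all_order all_algebra complex.
From mathcomp Require Import all_reals all_analysis.

Set Implicit Arguments.
Unset Strict Implicit.
Unset Printing Implicit Defensive.

Import Order.TTheory GRing.Theory Num.Theory.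
Import numFieldNormedType.Exports.

(** * Matching finite sets by keys, and leaves of acyclic graphs *)

(** Pair any [x] of [A] with some [y] of equal key, which the counts provide, and induct on the
    rest. Since [f] is total, [w0] serves as its default value when [A] is empty. *)
Lemma key_bijection (V W : finType) (K : eqType) (w0 : W) (k : V -> K)
    (l : W -> K) (A : {set V}) (B : {set W}) :
  (forall z, #|[set x in A | k x == z]| = #|[set y in B | l y == z]|) ->
  exists f : V -> W,
    [/\ {in A &, injective f}, f @: A = B & {in A, forall x, l (f x) = k x}].
Proof.
have [n] := ubnP #|A|; elim: n => // n IHn in A B *; rewrite ltnS => leAn cAB.
have [A0|[x xA]] := set_0Vmem A.
  exists (fun=> w0); rewrite A0; split; try by move=> ?; rewrite inE.
  rewrite imset0; apply/esym/eqP; apply: contraT => /set0Pn[y yB].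
  have := cAB (l y); rewrite A0 (_ : [set _ in _ | _] = set0); last first.
    by apply/setP=> z; rewrite !inE.
  by rewrite cards0 => /esym/eqP; rewrite cards_eq0 => /eqP/setP/(_ y);
     rewrite !inE yB eqxx.
have [y] : exists y, y \in [set y in B | l y == k x].
  by apply/card_gt0P; rewrite -cAB; apply/card_gt0P; exists x; rewrite !inE xA /=.
rewrite inE => /andP[yB /eqP lyx].
have [|z|f [injf imf keyf]] := IHn (A :\ x) (B :\ y).
- by move: leAn; rewrite (cardsD1 x A) xA.
- have := cAB z; rewrite (cardsD1 x) [in RHS](cardsD1 y) !inE xA yB lyx /=.
  move/addnI => e; move: e.
  by congr (_ = _); apply: eq_card => t; rewrite !inE !andbA.
exists (fun t => if t == x then y else f t).
have fB t : t \in A -> t != x -> f t \in B :\ y.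
  by move=> tA tx; rewrite -imf imset_f // !inE tx.
split.
- move=> s t sA tA; case: (eqVneq s x) => [->|sx]; case: (eqVneq t x) => [->|tx] //.
  + by move=> e; have := fB _ tA tx; rewrite -e !inE eqxx.
  + by move=> e; have := fB _ sA sx; rewrite e !inE eqxx.
  + by apply: injf; rewrite !inE ?sx ?tx.
- rewrite -(setD1K xA) imsetU1 eqxx -(setD1K yB) -imf; congr (_ |: _).
  by apply: eq_in_imset => t; rewrite !inE => /andP[/negPf-> _].
- by move=> t tA; case: (eqVneq t x) => [->|tx] //; apply: keyf; rewrite !inE tx.
Qed.

(* If every vertex had two neighbours in [A], a simple path in [A] could always be
   extended at its head, since a chord from the head would close a cycle. *)
Lemma acyclic_leaf (V : finType) (e : rel V) :
  symmetric e -> irreflexive e ->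
  (forall c : seq V, ucycle e c -> size c <= 2) ->
  forall A : {set V}, A != set0 ->
  exists2 x, x \in A & #|[set y in A | e x y]| <= 1.
Proof.
move=> e_sym e_irr acyc A /set0Pn[a aA].
have [/exists_inP[x xA lx]|] :=
  boolP [exists x in A, #|[set y in A | e x y]| <= 1]; first by exists x.
move/exists_inPn => deg2; exfalso.
suff [x [p [sp _ /card_uniqP up _]]] : exists x p,
    [/\ size p = #|V|, path e x p, uniq (x :: p) & all [in A] (x :: p)].
  by have := max_card (mem (x :: p)); rewrite up /= sp ltnn.
elim: #|V| => [|n [x [p [sp pp up pA]]]].
  by exists a, [::]; rewrite /= aA.
have xA : x \in A by case/andP: pA.
(* [head x p] is the next vertex of the path, to be avoided; for empty [p] it defaults to [x], which
   is not its own neighbour. *)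
have [z [zA xz zp]] : exists z, [/\ z \in A, e x z & z != head x p].
  have := deg2 _ xA; rewrite -ltnNge (cardsD1 (head x p)).
  case: (set_0Vmem ([set y in A | e x y] :\ head x p)) => [->|[z]].
    by rewrite cards0; case: (_ \in _).
  by rewrite !inE => /and3P[? ? ?] _; exists z.
have zx : z != x by apply: contraTneq xz => ->; rewrite e_irr.
have [zip|zNp] := boolP (z \in p); last first.
  exists z, (x :: p); split => //=; first by rewrite sp.
  - by rewrite e_sym xz.
  - by rewrite inE negb_or zx zNp; exact: up.
  - by rewrite zA; exact: pA.
case: p => // b q in sp pp up pA zp zip *.
move: zip; rewrite inE (negPf zp) /= => zq.
case/splitPr: zq => q1 q2 in sp pp up pA *.
(* As [z] differs from [b], this cycle has at least three vertices. *)
suff /acyc : ucycle e (x :: b :: rcons q1 z) by rewrite /= size_rcons.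
move: pp up; rewrite -cat_rcons -[b :: _ ++ _]cat_cons -[x :: _ ++ _]cat_cons.
rewrite cat_path cat_uniq => /andP[pp _] /andP[up _].
by apply/andP; split => //; rewrite /cycle rcons_path pp /= last_rcons e_sym.
Qed.

(** * Isomorphisms of acyclic graphs from equitable colourings *)

Section ColouredForests.
Variables (V W : finType) (C : eqType) (w0 : W).
Variables (e : rel V) (h : rel W) (cV : V -> C) (cW : W -> C).
Hypotheses (e_sym : symmetric e) (e_irr : irreflexive e).
Hypotheses (h_sym : symmetric h) (h_irr : irreflexive h).

(** Degrees are compared across the two graphs only. Equal class sizes give each vertex a partner of
    its colour on the other side, so equitability inside one graph follows. Restricting to [A] and
    [B] allows deletions. *)
Definition equitable_pair (A : {set V}) (B : {set W}) : Prop :=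
  (forall c, #|[set x in A | cV x == c]| = #|[set y in B | cW y == c]|) /\
  {in A & B, forall x y, cV x = cW y -> forall c,
    #|[set v in A | e x v && (cV v == c)]| =
    #|[set w in B | h y w && (cW w == c)]|}.

Definition coloured_iso (A : {set V}) (B : {set W}) (f : V -> W) : Prop :=
  [/\ {in A &, injective f}, f @: A = B, {in A, forall x, cW (f x) = cV x}
    & {in A &, forall x v, h (f x) (f v) = e x v}].

Lemma coloured_iso_glue (A S : {set V}) (B T : {set W}) (f g : V -> W) :
  S \subset A -> T \subset B ->
  coloured_iso (A :\: S) (B :\: T) f -> coloured_iso S T g ->
  {in S & A :\: S, forall x v, h (g x) (f v) = e x v} ->
  coloured_iso A B (fun x => if x \in S then g x else f x).
Proof.
move=> sSA sTB [injf imf colf adjf] [injg img colg adjg] adjgf.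
have fN x : x \in A -> x \notin S -> f x \in B :\: T.
  by move=> xA xS; rewrite -imf imset_f // inE xS.
have gT x : x \in S -> g x \in T by move=> xS; rewrite -img imset_f.
split.
- move=> x v xA vA; case: ifPn => xS; case: ifPn => vS exv.
  + exact: injg.
  + by have := fN _ vA vS; rewrite -exv inE gT.
  + by have := fN _ xA xS; rewrite exv inE gT.
  + by apply: injf => //; rewrite inE ?xS ?vS.
- rewrite -(setID A S) (setIidPr sSA) imsetU -(setID B T) (setIidPr sTB).
  congr (_ :|: _).
    by rewrite -img; apply: eq_in_imset => x ->.
  by rewrite -imf; apply: eq_in_imset => x; rewrite inE => /andP[/negPf-> _].
- by move=> x xA; case: ifPn => xS; [exact: colg | apply: colf; rewrite inE xS].
- move=> x v xA vA; case: ifPn => xS; case: ifPn => vS.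
  + exact: adjg.
  + by apply: adjgf => //; rewrite inE vS.
  + by rewrite h_sym e_sym; apply: adjgf => //; rewrite inE xS.
  + by apply: adjf => //; rewrite inE ?xS ?vS.
Qed.

(** The degree is the sum of the degrees into each colour. As [C] need not be finite, a
    colour-preserving bijection of the neighbourhoods replaces that sum. *)
Lemma equitable_pair_degree A B x y :
  equitable_pair A B -> x \in A -> y \in B -> cV x = cW y ->
  #|[set v in A | e x v]| = #|[set w in B | h y w]|.
Proof.
move=> [_ eqd] xA yB cxy.
have [|f [injf <- _]] := @key_bijection V W C w0 cV cW
    [set v in A | e x v] [set w in B | h y w].
  move=> c; have := eqd _ _ xA yB cxy c; rewrite -[RHS]/(#|_|).
  by congr (_ = _); apply: eq_card => z; rewrite !inE andbA.
by rewrite card_in_imset.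
Qed.

(** The leaf hypothesis covers all nonempty subsets, so it survives deletions. Through a partner
    [y], every vertex coloured like the leaf [x] has degree at most 1. The cases are whether [x] has
    a neighbour of its own colour. *)
Lemma equitable_pair_iso (A : {set V}) (B : {set W}) :
  (forall A' : {set V}, A' != set0 ->
     exists2 x, x \in A' & #|[set y in A' | e x y]| <= 1) ->
  equitable_pair A B -> exists f, coloured_iso A B f.
Proof.
move=> leafE; have [n] := ubnP #|A|; elim: n => // n IHn in A B *.
rewrite ltnS => leAn eqAB; have [sz eqd] := eqAB.
have [A0|An0] := eqVneq A set0.
  have [|f [injf imf colf]] := @key_bijection V W C w0 cV cW A B; first exact: sz.
  by exists f; split=> // x v; rewrite A0 inE.
have [x xA leafx] := leafE _ An0.
pose c := cV x.
pose S := [set v in A | cV v == c]; pose T := [set w in B | cW w == c].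
have cardST : #|S| = #|T| by exact: sz.
have xS : x \in S by rewrite inE xA /=.
have [y yT] : exists y, y \in T.
  by apply/card_gt0P; rewrite -cardST; apply/card_gt0P; exists x.
have [yB /eqP cy] : y \in B /\ cW y == c by apply/andP; rewrite inE in yT.
have degT w : w \in T -> #|[set w' in B | h w w']| = #|[set v in A | e x v]|.
  rewrite inE => /andP[wB /eqP cw].
  by apply/esym/equitable_pair_degree; rewrite // cw.
have degS v : v \in S -> #|[set v' in A | e v v']| = #|[set v in A | e x v]|.
  rewrite inE => /andP[vA /eqP cv]; rewrite -(degT y) //.
  by apply/equitable_pair_degree; rewrite // cv.
have [nbr0|] := eqVneq #|[set v in A | e x v && (cV v == c)]| 0.
  (* The zero count passes from [x] to all of [T], and back through [y] to all of [S]: both classes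
     are independent. *)
  have nbrT w w' : w \in T -> w' \in T -> h w w' = false.
    rewrite !inE => /andP[wB /eqP cw] /andP[w'B cw'].
    have := eqd x w xA wB (esym cw) c; rewrite nbr0 => /esym/eqP.
    by rewrite cards_eq0 => /eqP/setP/(_ w'); rewrite !inE w'B cw' andbT.
  have nbrS v v' : v \in S -> v' \in S -> e v v' = false.
    rewrite !inE => /andP[vA /eqP cv] /andP[v'A cv'].
    have := eqd x y xA yB (esym cy) c; rewrite nbr0.
    rewrite -(eqd v y vA yB) ?cv ?cy // => /esym/eqP.
    by rewrite cards_eq0 => /eqP/setP/(_ v'); rewrite !inE v'A cv' andbT.
  have [||f isof] := IHn (A :\: S) (B :\: T).
  - apply: leq_trans leAn; apply: proper_card; rewrite properE subsetDl.
    by apply/subsetPn; exists x; rewrite // inE xS.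
  (* Deleting whole classes makes all counts for colour [c] zero and leaves those for other colours
     unchanged. *)
  - split=> [c'|v w].
      have [->|cc'] := eqVneq c' c.
        rewrite !eq_card0 // => z; rewrite !inE;
        by do ![case: (_ \in _) => //=]; case: (_ == c).
      have := sz c'; congr (_ = _); apply: eq_card => z; rewrite !inE.
        by case: (eqVneq (cV z) c') => [->|]; rewrite ?andbF // (negPf cc') andbF.
      by case: (eqVneq (cW z) c') => [->|]; rewrite ?andbF // (negPf cc') andbF.
    rewrite !inE => /andP[_ vA] /andP[_ wB] cvw c'.
    have [->|cc'] := eqVneq c' c.
      rewrite !eq_card0 // => z; rewrite !inE;
      by do ![case: (_ \in _) => //=]; case: (_ == c) => //=; rewrite andbF.
    have := eqd _ _ vA wB cvw c'; congr (_ = _); apply: eq_card => z; rewrite !inE.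
      by case: (eqVneq (cV z) c') => [->|]; rewrite ?andbF // (negPf cc') andbF.
    by case: (eqVneq (cW z) c') => [->|]; rewrite ?andbF // (negPf cc') andbF.
  have [injf imf colf adjf] := isof.
  (* Class [c] is an independent set of leaves: send each leaf to one whose
     neighbourhood is the image under [f] of its own. *)
  pose k v := f @: [set v' in A :\: S | e v v'].
  pose l w := [set w' in B :\: T | h w w'].
  have cardl w : w \in T -> #|l w| = #|[set v in A | e x v]|.
    move=> wT; rewrite -(degT w wT); apply: eq_card => w'.
    rewrite [LHS]inE [RHS]inE in_setD.
    by case: (boolP (w' \in T)) => // w'T; rewrite nbrT ?andbF.
  have cardk v : v \in S -> #|k v| = #|[set v in A | e x v]|.
    move=> vS; rewrite -(degS v vS) card_in_imset; last first.
      move=> z1 z2; rewrite inE [z2 \in _]inE => /andP[? _] /andP[? _]; exact: injf.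
    apply: eq_card => v'; rewrite [LHS]inE [RHS]inE in_setD.
    by case: (boolP (v' \in S)) => // v'S; rewrite nbrS ?andbF.
  have memk v v' : v' \in A :\: S -> (f v' \in k v) = e v v'.
    move=> v'A; apply/imsetP/idP => [[z]|evv'].
      by rewrite inE => /andP[zA evz] /injf ->.
    by exists v' => //; rewrite inE v'A.
  have [Z|g [injg img keyg]] := @key_bijection V W {set W} w0 k l S T.
    (* A set whose size is not the common degree is a key on neither side. *)
    have [cZ|cZ] := eqVneq #|Z| #|[set v in A | e x v]|; last first.
      rewrite !eq_card0 // => z;
      rewrite [LHS]inE [RHS]inE; apply/negbTE/negP => /andP[zS /eqP eZ];
      by move/eqP: cZ; apply; rewrite -eZ ?cardl ?cardk.
    (* All keys have [#|Z|] elements, so equality with [Z] amounts to containing [Z], which becomes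
       an adjacency once [Z] is a singleton. *)
    have -> : [set v in S | k v == Z] = [set v in S | Z \subset k v].
      apply/setP => v; rewrite inE [RHS]inE; case: (boolP (v \in S)) => //= vS.
      by rewrite eq_sym eqEcard cardk // cZ leqnn andbT.
    have -> : [set w in T | l w == Z] = [set w in T | Z \subset l w].
      apply/setP => w; rewrite inE [RHS]inE; case: (boolP (w \in T)) => //= wT.
      by rewrite eq_sym eqEcard cardl // cZ leqnn andbT.
    have [->|Zn0] := eqVneq Z set0.
      have -> : [set v in S | set0 \subset k v] = S.
        by apply/setP => z; rewrite inE sub0set andbT.
      have -> // : [set w in T | set0 \subset l w] = T.
      by apply/setP => z; rewrite inE sub0set andbT.
    have /cards1P[w ->] : #|Z| == 1.
      by rewrite eqn_leq {1}cZ leafx card_gt0.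
    (* A vertex [w] outside the image of [f] occurs in no key. If [w = f v], equitability at colour
       [c] equates the numbers of leaves hanging from [v] and [f v]. *)
    have [wB|wNB] := boolP (w \in B :\: T); last first.
      rewrite !eq_card0 // => z;
      rewrite [LHS]inE [RHS]inE sub1set; apply/negbTE/negP => /andP[_].
        by move=> wl; move: wNB; rewrite inE in wl; case/andP: wl => ->.
      case/imsetP => v' ; rewrite inE => /andP[v'A _] ew.
      by move: wNB; rewrite ew -imf imset_f.
    move: wB; rewrite -imf => /imsetP[v vA' ->].
    have fvB : f v \in B :\: T by rewrite -imf imset_f.
    have [vA fvB'] : v \in A /\ f v \in B.
      by move: vA' fvB; rewrite !inE => /andP[_ ->] /andP[_ ->].
    have := eqd v (f v) vA fvB' (esym (colf _ vA')) c.
    congr (_ = _); apply: eq_card => z; rewrite inE [RHS]inE sub1set.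
      by rewrite memk // e_sym inE; case: (z \in A) => //=; rewrite andbC.
    rewrite [f v \in _]inE fvB /= h_sym inE.
    by case: (z \in B) => //=; rewrite andbC.
  exists (fun x => if x \in S then g x else f x).
  have gT v : v \in S -> g v \in T by move=> vS; rewrite -img imset_f.
  apply: (@coloured_iso_glue _ _ _ T) => //; rewrite ?subsetIl //.
  - by apply/subsetP => z; rewrite inE => /andP[].
  - by apply/subsetP => z; rewrite inE => /andP[].
  - split=> //.
      move=> v vS; have := gT _ vS; move: vS; rewrite !inE.
      by move=> /andP[_ /eqP->] /andP[_ /eqP].
    by move=> v v' vS v'S; rewrite nbrS // nbrT // gT.
  - move=> v v' vS v'A; rewrite -(memk v v') // -keyg // inE.
    by rewrite -imf imset_f.
rewrite -lt0n => nbr1.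
have /card_gt0P[x1] := nbr1; rewrite !inE => /and3P[x1A exx1 cx1].
have /card_gt0P[y1] : 0 < #|[set w in B | h y w && (cW w == c)]|.
  by rewrite -(eqd x) ?cy.
rewrite !inE => /and3P[y1B hyy1 cy1].
have x1S : x1 \in S by rewrite inE x1A.
have y1T : y1 \in T by rewrite inE y1B.
have x1x : x1 != x by apply: contraTneq exx1 => ->; rewrite e_irr.
have y1y : y1 != y by apply: contraTneq hyy1 => ->; rewrite h_irr.
have uniqS v v1 v2 : v \in S -> v1 \in A -> v2 \in A -> e v v1 -> e v v2 -> v1 = v2.
  move=> vS v1A v2A ev1 ev2; move: leafx; rewrite -(degS v vS).
  by move/card_le1_eqP; apply; rewrite inE ?v1A ?v2A.
have uniqT w w1 w2 : w \in T -> w1 \in B -> w2 \in B -> h w w1 -> h w w2 -> w1 = w2.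
  move=> wT w1B w2B hw1 hw2; move: leafx; rewrite -(degT w wT).
  by move/card_le1_eqP; apply; rewrite inE ?w1B ?w2B.
pose P := [set x; x1]; pose Q := [set y; y1].
(* Having degree at most 1, [x] and [x1] form a component by themselves, and so do [y] and [y1];
   deleting them changes no other degree. *)
have sepP v v' : v \in P -> v' \in A :\: P -> e v v' = false.
  rewrite !inE negb_or => vP /andP[/andP[v'x v'x1] v'A]; apply/negP => evv'.
  case/orP: vP => /eqP ev; rewrite ev in evv'.
    by move: v'x1; rewrite (uniqS x x1 v') ?eqxx.
  by move: v'x; rewrite (uniqS x1 x v') ?eqxx // e_sym.
have sepQ w w' : w \in Q -> w' \in B :\: Q -> h w w' = false.
  rewrite !inE negb_or => wQ /andP[/andP[w'y w'y1] w'B]; apply/negP => hww'.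
  case/orP: wQ => /eqP ew; rewrite ew in hww'.
    by move: w'y1; rewrite (uniqT y y1 w') ?eqxx.
  by move: w'y; rewrite (uniqT y1 y w') ?eqxx // h_sym.
have sPA : P \subset A by apply/subsetP => z; rewrite !inE => /orP[] /eqP->.
have sQB : Q \subset B by apply/subsetP => z; rewrite !inE => /orP[] /eqP->.
have [||f isof] := IHn (A :\: P) (B :\: Q).
- apply: leq_trans leAn; apply: proper_card; rewrite properE subsetDl.
  by apply/subsetPn; exists x; rewrite // !inE eqxx.
- split=> [c'|v w vA' wB' cvw c'].
    (* Both classes of colour [c] lose exactly two vertices. *)
    have [->|cc'] := eqVneq c' c.
      have -> : [set z in A :\: P | cV z == c] = S :\: P.
        by apply/setP => z; rewrite !inE andbA.
      have -> : [set z in B :\: Q | cW z == c] = T :\: Q.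
        by apply/setP => z; rewrite !inE andbA.
      have sPS : P \subset S by apply/subsetP => z; rewrite in_set2 => /orP[] /eqP->.
      have sQT : Q \subset T by apply/subsetP => z; rewrite in_set2 => /orP[] /eqP->.
      rewrite !cardsD (setIidPr sPS) (setIidPr sQT) cardST !cards2.
      by rewrite eq_sym x1x eq_sym y1y.
    have := sz c'; congr (_ = _); apply: eq_card => z; rewrite !inE.
      case: (eqVneq z x) => [->|_]; first by rewrite eq_sym (negPf cc') !andbF.
      case: (eqVneq z x1) => [->|_] //.
      by rewrite (eqP cx1) eq_sym (negPf cc') !andbF.
    case: (eqVneq z y) => [->|_]; first by rewrite cy eq_sym (negPf cc') !andbF.
    case: (eqVneq z y1) => [->|_] //.
    by rewrite (eqP cy1) eq_sym (negPf cc') !andbF.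
  have [vA wB] : v \in A /\ w \in B.
    by move: vA' wB'; rewrite !in_setD => /andP[_ ->] /andP[_ ->].
  have := eqd _ _ vA wB cvw c'; congr (_ = _); apply: eq_card => z.
    rewrite inE [RHS]inE in_setD; case: (boolP (z \in P)) => //= zP.
    by rewrite e_sym sepP // andbF.
  rewrite inE [RHS]inE in_setD; case: (boolP (z \in Q)) => //= zQ.
  by rewrite h_sym sepQ // andbF.
pose g v := if v == x then y else y1.
have gx : g x = y by rewrite /g eqxx.
have gx1 : g x1 = y1 by rewrite /g (negPf x1x).
have [injf imf colf adjf] := isof.
exists (fun x => if x \in P then g x else f x).
apply: (@coloured_iso_glue _ _ _ Q) => //.
- split.
  + move=> u v; rewrite !inE => /orP[] /eqP-> /orP[] /eqP->;
    rewrite ?gx ?gx1 // => /eqP; by rewrite ?(negPf y1y) // eq_sym (negPf y1y).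
  + by rewrite imsetU1 imset_set1 gx gx1.
  + by move=> u; rewrite !inE => /orP[] /eqP->; rewrite ?gx ?gx1 // ?cy // (eqP cy1) (eqP cx1).
  + move=> u v; rewrite !inE => /orP[] /eqP-> /orP[] /eqP->; rewrite ?gx ?gx1;
    by rewrite ?e_irr ?h_irr // ?hyy1 ?exx1 // h_sym e_sym hyy1 exx1.
- move=> u v uP vA'; rewrite sepP // sepQ // -?imf ?imset_f //.
  by rewrite /g; case: eqP => _; rewrite !inE eqxx ?orbT.
Qed.

End ColouredForests.

Local Open Scope ring_scope.

(** * Projections in a C*-algebra *)

Section CStar.
Variables (R : realType) (X : cstarAlgType R).

Lemma starM (x y : X) : star (x * y) = star y * star x.
Proof. exact: cs_starM. Qed.

Lemma starK : involutive (@star R X).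
Proof. exact: cs_starK. Qed.

Lemma starD : {morph @star R X : x y / x + y}.
Proof. exact: cs_starD. Qed.

Lemma star1 : star (1 : X) = 1.
Proof. by rewrite -[LHS](mulr1 (star 1)) -{2}[1]starK -starM mulr1 starK. Qed.

Lemma norm_starM (x : X) : `|star x * x| = `|x| ^+ 2 :> R[i].
Proof. exact: cs_norm_star. Qed.

Lemma cstar_normM (x y : X) : `|x * y| <= `|x| * `|y| :> R[i].
Proof. exact: cs_normM. Qed.

Lemma cstar_norm1 : `|1 : X| = 1 :> R[i].
Proof.
have n1 : `|1 : X| != 0 :> R[i] by rewrite normr_eq0 oner_eq0.
have := norm_starM 1; rewrite star1 mulr1 expr2 -{1}[`|_|]mulr1.
by move/(mulfI n1).
Qed.

(** [1 - 2p] is self-adjoint with square 1, so the C*-identity makes its squared norm 1. *)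
Lemma projection_reflection_norm (p : X) :
  is_projection p -> `|1 - (p + p)| = 1 :> R[i].
Proof.
move=> [sp pp].
have su : star (1 - (p + p)) = 1 - (p + p).
  apply: (addIr (p + p)); rewrite subrK -[RHS]star1 -{2}(subrK (p + p) 1).
  by rewrite [RHS]starD (starD p) sp.
apply/eqP; rewrite -(@eqrXn2 _ 2) // -norm_starM su expr1n.
have qq : (p + p) * (p + p) = p + p + (p + p) by rewrite mulrDl mulrDr pp.
by rewrite mulrBl mul1r mulrBr mulr1 qq opprB addrK subrK cstar_norm1.
Qed.

(* Each [1 - 2 p j] has norm at most 1, while multiplying their weighted sum over
   [j != i] by [p i] gives [(m + 2 c i) p i], where [m] is the total weight over
   [j != i]; comparing norms forces [p i = 0]. *)
Lemma projection_sum_eq0 (I : finType) (c : I -> nat) (p : I -> X) :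
  (forall i, is_projection (p i)) -> \sum_i p i *+ c i = 0 ->
  forall i, c i != 0%N -> p i = 0.
Proof.
move=> projp sum0 i ci; apply/eqP; rewrite -normr_eq0; apply/eqP.
have [_ pp] := projp i.
pose s := \sum_(j | j != i) (1 - p j *+ 2) *+ c j.
pose m := (\sum_(j | j != i) c j)%N.
have norm_s : `|s| <= m%:R :> R[i].
  apply: (le_trans (ler_norm_sum _ _ _)); rewrite natr_sum ler_sum // => j _.
  by rewrite normrMn mulr2n projection_reflection_norm.
have s_eq : p i * s = p i *+ (m + c i + c i).
  have -> : s = 1 *+ m + p i *+ (c i + c i).
    have rest : \sum_(j | j != i) p j *+ c j = - (p i *+ c i).
      by move/eqP: sum0; rewrite (bigD1 i) //= addrC addr_eq0 => /eqP.
    rewrite /s /m -sumrMnr mulrnDr -[p i *+ c i]opprK -rest -opprD -big_split -sumrB.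
    by apply: eq_bigr => j _; rewrite mulrnBl mulr2n mulrnDl.
  by rewrite mulrDr !mulrnAr mulr1 pp -mulrnDr addnA.
have := cstar_normM (p i) s; rewrite s_eq normrMn => le1.
have := le_trans le1 (ler_wpM2l (normr_ge0 _) norm_s).
rewrite mulr_natr -addnA mulrnDr gerDl => le2.
apply/eqP; rewrite eq_le normr_ge0 andbT; move: le2.
by rewrite pmulrn_lle0 // addn_gt0 lt0n ci.
Qed.

(** * Degrees by colour under a magic unitary *)

Section MagicUnitary.
Variables (V W : finType) (C : eqType) (cV : V -> C) (cW : W -> C).
Variables (e : rel V) (h : rel W) (u : W -> V -> X).

Hypothesis row_sum : forall w, \sum_v u w v = 1.
Hypothesis colour_u : forall w v, u w v != 0 -> cW w = cV v.
Hypothesis intertwine :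
  forall w v, \sum_(v' | e v' v) u w v' = \sum_(w' | h w w') u w' v.

Lemma colour_row_sum w c : \sum_(v | cV v == c) u w v = (cW w == c)%:R.
Proof.
have [<-|cw] := eqVneq; last first.
  rewrite big1 // => v /eqP cv; apply/eqP; apply: contraTT isT => /colour_u.
  by rewrite cv => /eqP; rewrite (negPf cw).
rewrite -(row_sum w) [RHS](bigID (fun v => cV v == cW w)) /=.
rewrite [X in _ + X]big1 ?addr0 // => v cv; apply/eqP.
by apply: contraNT cv => /colour_u ->.
Qed.

(** Double counting: sum over the end of colour [c] first, move the edge to the other graph by
    [intertwine], and collapse the row by [colour_row_sum]. Stated for rows, it also applies to the
    transpose. *)
Lemma row_degree_sum w c :
  \sum_v u w v *+ #|[set v' in [set: V] | e v v' && (cV v' == c)]| =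
  1 *+ #|[set w' in [set: W] | h w w' && (cW w' == c)]|.
Proof.
transitivity (\sum_v \sum_(v' | e v v' && (cV v' == c)) u w v).
  apply: eq_bigr => v _; rewrite sumr_const; congr (_ *+ _).
  by apply: eq_card => v'; rewrite !inE.
transitivity (\sum_(v' | cV v' == c) \sum_(v | e v v') u w v).
  rewrite (exchange_big_dep (fun v' => cV v' == c)) /=; last by move=> ? ? _ /andP[].
  by apply: eq_bigr => v' cv'; apply: eq_bigl => v; rewrite cv' andbT.
under eq_bigr => v' _ do rewrite intertwine.
rewrite exchange_big /=.
under eq_bigr => w' _ do rewrite colour_row_sum.
rewrite -sumr_const big_mkcond [RHS]big_mkcond /=; apply: eq_bigr => w' _.
by rewrite !inE; case: (h w w'); case: eqP.
Qed.

End MagicUnitary.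

Lemma magic_unitary_equitable (V W : finType) (C : eqType)
    (cV : V -> C) (cW : W -> C) (e : rel V) (h : rel W) (u : W -> V -> X) :
  symmetric e -> symmetric h ->
  (forall w v, is_projection (u w v)) ->
  (forall w, \sum_v u w v = 1) -> (forall v, \sum_w u w v = 1) ->
  (forall w v, u w v != 0 -> cW w = cV v) ->
  (forall w v, \sum_(v' | e v' v) u w v' = \sum_(w' | h w w') u w' v) ->
  (forall w v c, u w v != 0 ->
     #|[set v' in [set: V] | e v v' && (cV v' == c)]| =
     #|[set w' in [set: W] | h w w' && (cW w' == c)]|) /\
  (forall c, #|[set v in [set: V] | cV v == c]| =
             #|[set w in [set: W] | cW w == c]|).
Proof.
move=> e_sym h_sym proju rowu colu colouru inter; split; last first.
  (* Cardinals are compared as scalar multiples of [1], which is nonzero in a complex vector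
     space. *)
  move=> c; apply/eqP; rewrite -(eqr_nat R[i]) -subr_eq0.
  suff : ((#|[set v in [set: V] | cV v == c]|%:R
          - #|[set w in [set: W] | cW w == c]|%:R) : R[i]) *: (1 : X) == 0.
    by rewrite scaler_eq0 oner_eq0 orbF.
  rewrite scalerBl !scaler_nat subr_eq0 -!sumr_const.
  have -> : \sum_(w in [set w in [set: W] | cW w == c]) (1 : X) =
            \sum_w (cW w == c)%:R.
    rewrite big_mkcond; apply: eq_bigr => w _; rewrite !inE; by case: eqP.
  under [X in _ == X]eq_bigr => w _ do rewrite -(colour_row_sum rowu colouru).
  rewrite exchange_big /=; apply/eqP; apply: eq_big => v; first by rewrite !inE.
  by rewrite colu.
move=> w v c.
pose a w := #|[set w' in [set: W] | h w w' && (cW w' == c)]|.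
pose b v := #|[set v' in [set: V] | e v v' && (cV v' == c)]|.
rewrite -/(a w) -/(b v).
have rowd w' : \sum_v' u w' v' *+ b v' = 1 *+ a w' by exact: row_degree_sum.
have cold v' : \sum_w' u w' v' *+ a w' = 1 *+ b v'.
  (* The transpose, with the graphs exchanged; symmetry of [e] and [h] reverses the intertwining
     relation. *)
  apply: (@row_degree_sum W V C cW cV h e (fun v w => u w v)) => //.
    by move=> ? ? /colouru.
  move=> v1 w1; rewrite (eq_bigl (h w1)) => [|?]; last exact: h_sym.
  by rewrite -inter; apply: eq_bigl => ?; exact: e_sym.
have sumab : \sum_w' \sum_v' u w' v' *+ (a w' * b v') = \sum_w' 1 *+ a w' ^ 2.
  apply: eq_bigr => w' _; rewrite -mulnn mulrnA -rowd -sumrMnl.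
  by apply: eq_bigr => v' _; rewrite -mulrnA mulnC.
have sumba : \sum_w' \sum_v' u w' v' *+ (a w' * b v') = \sum_v' 1 *+ b v' ^ 2.
  rewrite exchange_big; apply: eq_bigr => v' _; rewrite -mulnn mulrnA -cold -sumrMnl.
  by apply: eq_bigr => w' _; rewrite -mulrnA.
(* This is the square of the difference of [a] and [b]; by [nat_Cauchy] the subtraction does not
   truncate. *)
pose d (i : W * V) := (a i.1 ^ 2 + b i.2 ^ 2 - 2 * (a i.1 * b i.2))%N.
have := @projection_sum_eq0 _ d (fun i => u i.1 i.2) (fun i => proju i.1 i.2).
move=> zero; apply: contra_neq_eq => ba.
apply: (zero _ (w, v)); last first.
  rewrite /d /= subn_eq0 -ltnNge ltn_neqAle !(nat_Cauchy (a w) (b v)) andbT.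
  by rewrite eq_sym.
rewrite -(pair_bigA _ (fun w v => u w v *+ (a w ^ 2 + b v ^ 2 - 2 * (a w * b v)))) /=.
(* Split each weight as [(a^2 - ab) + (b^2 - ab)]: the first part cancels by row sums and [sumab],
   the second by column sums and [sumba]. *)
under eq_bigr => w' _ do under eq_bigr => v' _ do
  rewrite mulrnBr ?nat_Cauchy // mulrnDr mul2n -addnn mulrnDr opprD addrACA.
under eq_bigr => w' _ do rewrite big_split /=.
rewrite big_split /=.
under eq_bigr => w' _ do rewrite sumrB sumrMnl rowu.
under [X in _ + X]eq_bigr => w' _ do rewrite sumrB.
rewrite !sumrB sumab subrr add0r exchange_big -sumab sumba.
by under eq_bigr => v' _ do rewrite sumrMnl colu; rewrite subrr.
Qed.

End CStar.

Local Close Scope ring_scope.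

(** * From quantum isomorphism to isomorphism of trees *)

Lemma quantum_isomorphic_equitable (R : realType) (G H : graph) :
  quantum_isomorphic R G H ->
  exists (C : eqType) (cG : G -> C) (cH : H -> C),
    equitable_pair (@adj G) (@adj H) cG cH [set: G] [set: H].
Proof.
move=> [_ [X [U [[_ projU rowU colU] comm]]]].
pose u (y : H) (x : G) : X := U (enum_rank y) (enum_rank x).
have inter y x : (\sum_(x' | adj x' x) u y x' = \sum_(y' | adj y y') u y' x)%R.
  have /matrixP/(_ (enum_rank y) (enum_rank x)) := comm; rewrite !mxE => eq_yx.
  transitivity (\sum_j U (enum_rank y) j * adj_mx X G j (enum_rank x))%R.
    rewrite (reindex (@enum_rank G)) /=; last exact/onW_bij/enum_rank_bij.
    rewrite big_mkcond; apply: eq_bigr => x' _; rewrite mxE !enum_rankK.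
    by case: adj; rewrite ?mulr1 ?mulr0.
  rewrite eq_yx (reindex (@enum_rank H)) /=; last exact/onW_bij/enum_rank_bij.
  rewrite [RHS]big_mkcond; apply: eq_bigr => y' _; rewrite mxE !enum_rankK.
  by case: adj; rewrite ?mul1r ?mul0r.
have rowu y : (\sum_x u y x = 1)%R.
  rewrite -(rowU (enum_rank y)) [RHS](reindex (@enum_rank G)) //.
  exact/onW_bij/enum_rank_bij.
have colu x : (\sum_y u y x = 1)%R.
  rewrite -(colU (enum_rank x)) [RHS](reindex (@enum_rank H)) //.
  exact/onW_bij/enum_rank_bij.
pose r (s t : G + H) := match s, t with
  | inl x, inr y | inr y, inl x => u y x != 0%R
  | _, _ => false
  end.
have r_sym : connect_sym r by apply: sym_connect_sym => -[x|y] [x'|y'].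
pose cG x := fingraph.root r (inl x); pose cH y := fingraph.root r (inr y).
have coloru y x : u y x != 0%R -> cH y = cG x.
  by move=> uyx; apply/esym/(fingraph.rootP r_sym)/connect1.
have [degu sizeu] := magic_unitary_equitable (@adj_sym G) (@adj_sym H)
  (fun y x => projU _ _) rowu colu coloru inter.
exists (G + H)%type, cG, cH; split=> [//|x y _ _ /(fingraph.rootP r_sym) cxy c].
pose d (s : G + H) := match s with
  | inl x => #|[set x' in [set: G] | adj x x' && (cG x' == c)]|
  | inr y => #|[set y' in [set: H] | adj y y' && (cH y' == c)]|
  end.
(* Equal colours only give a chain of nonzero entries from [x] to [y]; [d] is constant along each
   link. *)
have closed_d : fingraph.closed r [pred s | d s == d (inr y)].
  by move=> [x1|y1] [x2|y2] //= /degu e12; rewrite !inE /= e12.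
by have := closed_connect closed_d cxy; rewrite !inE eqxx => /eqP.
Qed.

Theorem theorem6p24 (R : realType) : superrigid R is_tree.
Proof.
move=> T G [_ acycT] qTG.
have [C [cT [cG eqTG]]] := quantum_isomorphic_equitable qTG.
have [g0 _] : exists g : G, g \in G by apply/card_gt0P/vertex_gt0.
have leafT := acyclic_leaf (@adj_sym T) (@adj_irr T) acycT.
have [f [injf imf _ adjf]] := equitable_pair_iso g0 (@adj_sym T) (@adj_irr T)
  (@adj_sym G) (@adj_irr G) leafT eqTG.
have f_inj : injective f by move=> x y; apply: injf.
have surjf y : y \in codom f.
  have : y \in f @: [set: T] by rewrite imf inE.
  by case/imsetP => x _ ->; exact: codom_f.
(* [f] maps [T] to [G], while [graph_isomorphic G T] asks for a map out of [G]: its inverse. *)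
pose g y := iinv (surjf y).
have fgK : cancel g f by move=> y; exact: f_iinv.
have gfK : cancel f g by move=> x; apply: f_inj; rewrite fgK.
exists g; first exact: (Bijective fgK gfK).
by move=> x y; rewrite -adjf ?inE // !fgK.
Qed.
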